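(* Let $\alpha\ge0$ and let $f\in\Sigma$ be of the form $f(z)=z^{-1}-\sum_{n=1}^{\infty}a_nz^n$ with $a_n\ge0$ for all $n\ge1$. Then $f\in TME(\alpha)$ if and only if $$\sum_{n=1}^{\infty}(1+\alpha(n+1))\,a_n\le1.$$ The result is sharp: for each $n=1,2,3,\dots$ the function $f(z)=z^{-1}-\frac{1}{1+\alpha(n+1)}z^n$ belongs to $TME(\alpha)$ and gives equality in this inequality.
   Context: Let $E=\{z\in\mathbb{C}: 0<|z|<1\}$. Let $\Sigma$ be the family of functions $f(z)=z^{-1}+\sum_{n=0}^{\infty}a_nz^n$ ($a_n\in\mathbb{C}$) that are analytic in $E$, with a simple pole at $z=0$. For $0\le\alpha$, $ME(\alpha)$ is the set of $f\in\Sigma$ such that $\operatorname{Re}(zf(z))>\alpha\,|z^2f'(z)+zf(z)|$ for all $z\in E$. $TME(\alpha)$ is the set of all $f\in ME(\alpha)$ of the form $f(z)=z^{-1}-\sum_{n=1}^{\infty}a_nz^n$ with all $a_n\ge0$. *)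

(* Defs.v *)
From Stdlib Require Export Reals.
From Coquelicot Require Export Coquelicot.

Open Scope R_scope.

(** [0 < |z| < 1]. *)
Definition E (z : C) : Prop := 0 < Cmod z < 1.

Definition analytic_on (D : C -> Prop) (f : C -> C) : Prop :=
  forall z : C, D z -> ex_derive (K := C_AbsRing) (V := C_NormedModule) f z.

(** [sum_{n >= 1} u n] converges to [s]. *)
Definition is_series1 {K : AbsRing} {V : NormedModule K} (u : nat -> V) (s : V)
  : Prop := is_series (fun k => u (S k)) s.

(** Functions are total on [C], but only their values on [E] matter.  The
    simple pole at [0] is the principal part [/ z] of the expansion. *)
Definition Sigma (f : C -> C) : Prop :=
  analytic_on E f /\
  exists a : nat -> C, forall z : C, E z ->
    is_series (K := C_AbsRing) (V := C_NormedModule)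
      (fun n => a n * z ^ n)%C (f z - / z)%C.

(** [f z = / z - sum_{n >= 1} a n z^n] on [E] with [a n >= 0] for [n >= 1];
    the value [a 0] is irrelevant. *)
Definition has_nonneg_form (f : C -> C) (a : nat -> R) : Prop :=
  (forall n : nat, (1 <= n)%nat -> 0 <= a n) /\
  (forall z : C, E z ->
    is_series1 (K := C_AbsRing) (V := C_NormedModule)
      (fun n => RtoC (a n) * z ^ n)%C (/ z - f z)%C).

Definition ME (alpha : R) (f : C -> C) : Prop :=
  Sigma f /\
  forall z : C, E z ->
    Re (z * f z)%C > alpha * Cmod (z ^ 2 * C_derive f z + z * f z)%C.

Definition TME (alpha : R) (f : C -> C) : Prop :=
  ME alpha f /\ exists a : nat -> R, has_nonneg_form f a.

Definition weighted_coef (alpha : R) (a : nat -> R) (n : nat) : R :=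
  (1 + alpha * (INR n + 1)) * a n.

Definition extremal_coef (alpha : R) (n : nat) : R :=
  / (1 + alpha * (INR n + 1)).

Definition extremal_fun (alpha : R) (n : nat) (z : C) : C :=
  (/ z - RtoC (extremal_coef alpha n) * z ^ n)%C.

(** Coefficient sequence of [extremal_fun alpha n]. *)
Definition extremal_seq (alpha : R) (n k : nat) : R :=
  if Nat.eqb k n then extremal_coef alpha n else 0.

(* Main.v *)
(** Put [D z = z^2 f'(z) + z f(z)], the derivative of [t z f(t z)] at [t = 1].
    Then [z f(z) = 1 - sum a_n z^(n+1)] and [D z = - sum (n+1) a_n z^(n+1)], so
    nonnegativity of the [a_n] makes the positive real axis the worst case:
    with [r = |z|], [Re (z f(z)) >= r f(r)] and [|D z| <= - D r].  Hence [ME]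
    says that [r f(r) + alpha D r = 1 - sum (1 + alpha (n+1)) a_n r^(n+1)] is
    positive for [0 < r < 1], and one lets [r] tend to 1.  Strictness in the
    converse comes from the factor [r^2 < 1] in every term. *)

Require Import Defs.
From Stdlib Require Import Reals Lra Lia.
From Coquelicot Require Import Coquelicot.
Open Scope R_scope.

(** * Complex differentiation *)

(** A form in terms of [Cmod] alone permits direct estimates and carries derivatives between the two
    normed-module structures on [C]. *)
Lemma is_derive_C_epsilon (f : C -> C) (z l : C) :
  is_derive (K := C_AbsRing) (V := C_NormedModule) f z l <->
  forall eps : R, 0 < eps -> exists d : R, 0 < d /\ forall w : C,
    Cmod (w - z) < d -> Cmod (f w - f z - (w - z) * l) <= eps * Cmod (w - z).
Proof.
split.
- intros [_ H] eps Heps.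
  destruct (H z (fun P HP => HP) (mkposreal eps Heps)) as [d Hd].
  exists d; split; [apply cond_pos|].
  intros w Hw; exact (Hd w Hw).
- intros H; split; [apply is_linear_scal_l|].
  intros x Hx eps.
  rewrite <- (is_filter_lim_locally_unique (K := C_AbsRing)
    (V := AbsRing_NormedModule C_AbsRing) z x Hx).
  destruct (H eps (cond_pos eps)) as [d [Hd Hf]].
  exists (mkposreal d Hd); intros w Hw; exact (Hf w Hw).
Qed.

Lemma ex_derive_C_inv (z : C) :
  z <> 0 -> ex_derive (K := C_AbsRing) (V := C_NormedModule) Cinv z.
Proof.
intros Hz.
exists (- (/ z * / z))%C.
apply is_derive_C_epsilon; intros eps Heps.
assert (Hm : 0 < Cmod z) by (apply Cmod_gt_0; exact Hz).
assert (Hm3 : 0 < Cmod z ^ 3) by (apply pow_lt; exact Hm).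
(* The remainder equals [(w - z)^2 / (w * z^2)]. The first bound gives [|w| > |z|/2]; with it, the
   second gives [|w - z| <= eps * |w| * |z|^2]. *)
exists (Rmin (Cmod z / 2) (eps * Cmod z ^ 3 / 2)); split.
{ apply Rmin_glb_lt; [lra|].
  apply Rmult_lt_0_compat; [apply Rmult_lt_0_compat; assumption|lra]. }
intros w Hw.
assert (Hw1 := Rlt_le_trans _ _ _ Hw (Rmin_l _ _)).
assert (Hw2 := Rlt_le_trans _ _ _ Hw (Rmin_r _ _)).
assert (Hwz : Cmod z / 2 < Cmod w).
{ assert (H := Cmod_triangle w (z - w)).
  replace (w + (z - w))%C with z in H by ring.
  rewrite <- (Cmod_opp (z - w)) in H.
  replace (- (z - w))%C with (w - z)%C in H by ring.
  lra. }
assert (Hw0 : w <> 0) by (apply Cmod_gt_0; lra).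
replace (/ w - / z - (w - z) * - (/ z * / z))%C
  with ((w - z) * ((w - z) * / (w * z ^ 2)))%C by (simpl; field; auto).
rewrite !Cmod_mult, Rmult_comm.
apply Rmult_le_compat_r; [apply Cmod_ge_0|].
rewrite Cmod_inv by (apply Cmult_neq_0; [|apply Cpow_nz]; assumption).
rewrite Cmod_mult, Cmod_pow.
assert (Hd : 0 < Cmod w * Cmod z ^ 2).
{ apply Rmult_lt_0_compat; [lra|apply pow_lt; exact Hm]. }
apply (Rmult_le_reg_r (Cmod w * Cmod z ^ 2)); [exact Hd|].
rewrite Rmult_assoc, Rinv_l, Rmult_1_r by lra.
apply Rle_trans with (eps * Cmod z ^ 3 / 2); [lra|].
replace (eps * Cmod z ^ 3 / 2) with (eps * (Cmod z / 2 * Cmod z ^ 2)) by field.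
apply Rmult_le_compat_l; [lra|].
apply Rmult_le_compat_r; [apply pow_le|]; lra.
Qed.

(** Serves twice: by induction for the powers of [z], and for the function [w * f w] that is
    followed along rays. *)
Lemma is_derive_C_mult_id (f : C -> C) (z l : C) :
  is_derive (K := C_AbsRing) (V := C_NormedModule) f z l ->
  is_derive (K := C_AbsRing) (V := C_NormedModule)
    (fun w => w * f w)%C z (f z + z * l)%C.
Proof.
intros H.
assert (Hf : is_derive (K := C_AbsRing)
  (V := AbsRing_NormedModule C_AbsRing) f z l).
{ destruct H as [[H1 H2 H3] H]; split; [split|]; assumption. }
assert (Hm := is_derive_mult (K := C_AbsRing) (fun w => w) f z one l
  (is_derive_id z) Hf Cmult_comm).
apply is_derive_C_epsilon; intros eps Heps.
destruct Hm as [_ Hm].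
destruct (Hm z (fun P HP => HP) (mkposreal eps Heps)) as [d Hd].
exists d; split; [apply cond_pos|].
intros w Hw; generalize (Hd w Hw).
replace (f z + z * l)%C with (1 * f z + z * l)%C by ring.
exact (fun h => h).
Qed.

Lemma ex_derive_C_pow (n : nat) (z : C) :
  ex_derive (K := C_AbsRing) (V := C_NormedModule) (fun w => w ^ n)%C z.
Proof.
induction n as [|n [l IH]].
- apply (ex_derive_const (K := C_AbsRing) (V := C_NormedModule) (RtoC 1)).
- exists (z ^ n + z * l)%C; exact (is_derive_C_mult_id _ _ _ IH).
Qed.

(** Chain rule for the ray [t * z] followed by the real-linear functional [Re (c * _)]; it turns a
    complex derivative into the derivative of a real function of [t]. *)
Lemma is_derive_Re_radial (F : C -> C) (z l c : C) :
  is_derive (K := C_AbsRing) (V := C_NormedModule) F z l ->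
  is_derive (fun t : R => Re (c * F (RtoC t * z))%C) 1 (Re (c * (z * l))%C).
Proof.
intros HF.
split; [apply is_linear_scal_l|].
intros x Hx eps.
rewrite <- (is_filter_lim_locally_unique (K := R_AbsRing)
    (V := R_NormedModule) 1 x Hx).
clear x Hx.
assert (HK : 0 < Cmod c * Cmod z + 1).
{ assert (H := Rmult_le_pos _ _ (Cmod_ge_0 c) (Cmod_ge_0 z)); lra. }
(* The tolerance absorbs the factor [|c| * |z|] that appears below; the added 1 keeps the
   denominator positive when [c] or [z] vanishes. *)
destruct (proj1 (is_derive_C_epsilon F z l) HF (eps / (Cmod c * Cmod z + 1)))
  as [d [Hd H]].
{ apply Rdiv_lt_0_compat; [apply cond_pos|exact HK]. }
assert (Hz : 0 < Cmod z + 1) by (assert (h := Cmod_ge_0 z); lra).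
exists (mkposreal (d / (Cmod z + 1)) (Rdiv_lt_0_compat _ _ Hd Hz)).
intros t Ht.
change (Rabs (t - 1) < d / (Cmod z + 1)) in Ht.
change (Rabs (Re (c * F (RtoC t * z))%C - Re (c * F (RtoC 1 * z))%C
  - (t - 1) * Re (c * (z * l))%C) <= eps * Rabs (t - 1)).
assert (Hm : Cmod (RtoC t * z - z) = Rabs (t - 1) * Cmod z).
{ rewrite <- Cmod_R, <- Cmod_mult; f_equal.
  rewrite RtoC_minus; ring. }
specialize (H (RtoC t * z)%C); rewrite Hm in H.
assert (Ht' : Rabs (t - 1) * (Cmod z + 1) < d).
{ apply (Rmult_lt_compat_r _ _ _ Hz) in Ht.
  replace (d / (Cmod z + 1) * (Cmod z + 1)) with d in Ht by (field; lra).
  exact Ht. }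
assert (H0 := Rabs_pos (t - 1)).
specialize (H ltac:(lra)).
replace (Re (c * F (RtoC t * z))%C - Re (c * F (RtoC 1 * z))%C
  - (t - 1) * Re (c * (z * l))%C) with
  (Re (c * (F (RtoC t * z) - F z - (RtoC t * z - z) * l))%C).
2:{ replace (RtoC 1 * z)%C with z by ring.
    replace (RtoC t * z - z)%C with (RtoC (t - 1) * z)%C
      by (rewrite RtoC_minus; ring).
    rewrite <- (re_scal_l (t - 1)).
    replace (c * (F (RtoC t * z) - F z - RtoC (t - 1) * z * l))%C
      with (c * F (RtoC t * z) + (- (c * F z) + - (RtoC (t - 1) * (c * (z * l)))))%C
      by ring.
    unfold Re; simpl; ring. }
apply Rle_trans with (1 := re_le_Cmod _).
rewrite Cmod_mult.
apply Rle_trans with (1 := Rmult_le_compat_l _ _ _ (Cmod_ge_0 c) H).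
apply (Rmult_le_reg_r (Cmod c * Cmod z + 1)); [exact HK|].
replace (Cmod c * (eps / (Cmod c * Cmod z + 1) * (Rabs (t - 1) * Cmod z))
  * (Cmod c * Cmod z + 1)) with (eps * Rabs (t - 1) * (Cmod c * Cmod z))
  by (field; lra).
apply Rmult_le_compat_l; [|lra].
apply Rmult_le_pos; [apply Rlt_le, cond_pos|exact H0].
Qed.

(** * Real parts of series and one-term series *)

Lemma is_series_Re (u : nat -> C) (l : C) :
  is_series (K := C_AbsRing) (V := C_NormedModule) u l ->
  is_series (fun n => Re (u n)) (Re l).
Proof.
intros H P [e He].
assert (HP : locally (T := C_NormedModule) l (fun w => P (Re w))).
(* Balls of [C_NormedModule] are products of real balls, so the first coordinate controls [Re]. *)
{ exists e; intros w [Hw _]; apply He; exact Hw. }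
destruct (H _ HP) as [N HN].
exists N; intros n Hn.
assert (Hs : forall m, sum_n (G := R_NormedModule) (fun k => Re (u k)) m
  = Re (sum_n (G := C_NormedModule) u m)).
{ induction m as [|m IH]; [rewrite !sum_O; reflexivity|].
  rewrite !sum_Sn, IH; reflexivity. }
rewrite Hs; exact (HN n Hn).
Qed.

(** The partial sums are constant from index [n] on. *)
Lemma is_series_single {K : AbsRing} {V : NormedModule K} (u : nat -> V)
  (n : nat) :
  (forall k : nat, k <> n -> u k = zero) -> is_series u (u n).
Proof.
intros Hu.
apply filterlim_ext_loc with (fun _ => u n); [|apply filterlim_const].
exists n; intros m Hm.
assert (H0 : forall j, (j < n)%nat -> sum_n u j = zero).
{ induction j as [|j IH]; intros Hj.
  - rewrite sum_O; apply Hu; lia.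
  - rewrite sum_Sn, IH, Hu, plus_zero_r by lia; reflexivity. }
induction Hm as [|m Hm IH].
- destruct n as [|n]; [rewrite sum_O; reflexivity|].
  rewrite sum_Sn, H0, plus_zero_l by lia; reflexivity.
- rewrite sum_Sn, <- IH, (Hu (S m)), plus_zero_r by lia; reflexivity.
Qed.

(** * Real series for [z f(z)] and for its radial derivative *)

Lemma E_neq_0 (z : C) : E z -> z <> 0.
Proof. intros [H _]; apply Cmod_gt_0; exact H. Qed.

(** Multiplying the expansion by [c * z] removes the pole and raises each exponent by one. The free
    factor [c] lets real series retain the complex information. *)
Lemma form_series (f : C -> C) (a : nat -> R) (c z : C) :
  has_nonneg_form f a -> E z ->
  is_series (fun k => a (S k) * Re (c * z ^ S (S k))%C) (Re (c * (1 - z * f z))%C).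
Proof.
intros Hf Hz.
assert (H := is_series_Re _ _ (is_series_scal (c * z)%C _ _ (proj2 Hf z Hz))).
replace (c * (1 - z * f z))%C with (scal (c * z)%C (/ z - f z)%C).
2:{ change (c * z * (/ z - f z) = c * (1 - z * f z))%C.
    field; apply E_neq_0; exact Hz. }
revert H; apply is_series_ext; intros n.
change (scal (c * z)%C (RtoC (a (S n)) * z ^ S n)%C)
  with (c * z * (RtoC (a (S n)) * z ^ S n))%C.
replace (c * z * (RtoC (a (S n)) * z ^ S n))%C
  with (RtoC (a (S n)) * (c * z ^ S (S n)))%C by (rewrite !Cpow_S; ring).
apply re_scal_l.
Qed.

(* Along the ray [t z] the function [t z f(t z)] is a real power series in [t]
   (after applying [Re (c * _)]), with radius of convergence above 1, so it may
   be differentiated term by term at [t = 1]. *)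
Lemma form_derive_series (f : C -> C) (a : nat -> R) (c z : C) :
  has_nonneg_form f a -> E z ->
  ex_derive (K := C_AbsRing) (V := C_NormedModule) f z ->
  is_series (fun k => (INR (S k) + 1) * a (S k) * Re (c * z ^ S (S k))%C)
    (- Re (c * (z ^ 2 * C_derive f z + z * f z))%C).
Proof.
intros Hf Hz Hd.
(* Coefficients in powers of [t]: the expansion starts with [a 1] at degree 2, hence zeros at 0 and
   1. *)
set (b := fun k => match k with
  | S (S j) => a (S j) * Re (c * z ^ S (S j))%C | _ => 0 end).
assert (Hb : forall t, 0 < t -> t * Cmod z < 1 ->
  is_pseries b t (Re (c * (1 - RtoC t * z * f (RtoC t * z)))%C)).
{ intros t Ht Htz.
  assert (HE : E (RtoC t * z)).
  { unfold E; rewrite Cmod_mult, Cmod_R, Rabs_pos_eq by lra.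
    split; [apply Rmult_lt_0_compat; [exact Ht|apply Hz]|exact Htz]. }
  apply (is_series_decr_n _ 2); [lia|].
  unfold Init.Nat.pred; rewrite sum_Sn, sum_O.
  set (L := Re _).
  replace (plus L _) with L.
  2:{ change (L = L + - (1 * 0 + t * 1 * 0)); ring. }
  generalize (form_series f a c _ Hf HE); apply is_series_ext; intros k.
  change (a (S k) * Re (c * (RtoC t * z) ^ S (S k))%C
    = pow_n (K := R_Ring) t (2 + k) * (a (S k) * Re (c * z ^ S (S k))%C)).
  rewrite pow_n_pow, Cpow_mult_l, <- RtoC_pow.
  replace (c * (RtoC (t ^ S (S k)) * z ^ S (S k)))%C
    with (RtoC (t ^ S (S k)) * (c * z ^ S (S k)))%C by ring.
  rewrite re_scal_l; simpl; ring. }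
(* The midpoint of 1 and [1 / |z|]: it exceeds 1, yet [t1 * z] still lies in [E]. *)
set (t1 := (/ Cmod z + 1) / 2).
assert (Hz1 : 1 < / Cmod z).
{ rewrite <- Rinv_1; apply Rinv_lt_contravar; [rewrite Rmult_1_r|]; apply Hz. }
assert (Ht1 : 1 < t1) by (unfold t1; lra).
assert (Ht1z : t1 * Cmod z < 1).
{ unfold t1; replace ((/ Cmod z + 1) / 2 * Cmod z) with ((1 + Cmod z) / 2)
    by (field; apply Rgt_not_eq, Hz).
  destruct Hz; lra. }
assert (Hr : Rbar_lt (Rabs 1) (CV_radius b)).
{ rewrite Rabs_R1.
  apply Rbar_lt_le_trans with (Rabs t1); [rewrite Rabs_pos_eq; simpl; lra|].
  (* Convergence at [t1] makes the terms tend to 0, which is impossible outside the disk of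
     convergence. *)
  apply Rbar_not_lt_le; intros Hlt.
  apply (CV_disk_outside b t1 Hlt).
  apply (is_lim_seq_ext (fun n => scal (pow_n (K := R_Ring) t1 n) (b n))).
  - intros n; rewrite pow_n_pow; apply Rmult_comm.
  - apply ex_series_lim_0; eexists; apply (Hb t1); lra. }
(* Near 1 the power series coincides with [Re c - Re (c * (t z f(t z)))], which the chain rule along
   the ray differentiates. *)
assert (HD : Derive (PSeries b) 1
  = - Re (c * (z ^ 2 * C_derive f z + z * f z))%C).
{ apply is_derive_unique.
  assert (H := is_derive_Re_radial _ _ _ c
    (is_derive_C_mult_id _ _ _ (C_derive_correct f z z Hd))).
  apply is_derive_opp in H.
  apply (is_derive_plus (fun _ => Re c)) with (1 := is_derive_const (Re c) 1) in H.
  replace (- Re (c * (z ^ 2 * C_derive f z + z * f z))%C) with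
    (plus zero (opp (Re (c * (z * (f z + z * C_derive f z)))%C))).
  2:{ rewrite plus_zero_l; change (opp (Re (c * (z * (f z + z * C_derive f z)))%C))
        with (- Re (c * (z * (f z + z * C_derive f z)))%C).
      do 3 f_equal; ring. }
  revert H; apply is_derive_ext_loc.
  (* Within this radius of 1 one has [0 < t < t1], where [Hb] applies. *)
  assert (Ht1' : 0 < Rmin 1 (t1 - 1)) by (apply Rmin_glb_lt; lra).
  exists (mkposreal _ Ht1'); intros t Ht.
  change (Rabs (t - 1) < Rmin 1 (t1 - 1)) in Ht.
  assert (Hlt1 := Rlt_le_trans _ _ _ Ht (Rmin_l _ _)).
  assert (Hlt2 := Rlt_le_trans _ _ _ Ht (Rmin_r _ _)).
  apply Rabs_def2 in Hlt1; apply Rabs_def2 in Hlt2.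
  rewrite (is_pseries_unique b t _ (Hb t ltac:(lra)
    (Rle_lt_trans _ _ _ (Rmult_le_compat_r _ _ _ (Cmod_ge_0 z)
       (Rlt_le t t1 ltac:(lra))) Ht1z))).
  change (Re c + - Re (c * (RtoC t * z * f (RtoC t * z)))%C
    = Re (c * (1 - RtoC t * z * f (RtoC t * z)))%C).
  unfold Re; simpl; ring. }
rewrite <- HD.
assert (H := is_pseries_derive b 1 Hr).
(* The dropped term is [PS_derive b 0 = INR 1 * b 1 = 0]; the shift aligns the index with
   [a (S k)]. *)
assert (H0 : is_series (fun k => PS_derive b (S k)) (Derive (PSeries b) 1)).
{ apply (is_series_incr_1 (PS_derive b)).
  set (L := Derive _ _) in H |- *.
  replace (plus L _) with L.
  2:{ change (L = L + INR 1 * 0); ring. }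
  revert H; apply is_series_ext; intros k.
  rewrite pow_n_pow, pow1; apply Rmult_1_l. }
revert H0; apply is_series_ext; intros k.
change (INR (S (S k)) * (a (S k) * Re (c * z ^ S (S k))%C)
  = (INR (S k) + 1) * a (S k) * Re (c * z ^ S (S k))%C).
rewrite (S_INR (S k)); ring.
Qed.

(** * Comparison with the positive real axis *)

Lemma is_series_le (u v : nat -> R) (lu lv : R) :
  (forall n : nat, u n <= v n) -> is_series u lu -> is_series v lv -> lu <= lv.
Proof.
intros Huv Hu Hv.
apply (is_lim_seq_le (sum_n u) (sum_n v) lu lv); [|exact Hu|exact Hv].
intros n; apply sum_n_m_le; exact Huv.
Qed.

Lemma E_Cmod (z : C) : E z -> E (RtoC (Cmod z)).
Proof.
intros [H0 H1]; unfold E; rewrite Cmod_R, Rabs_pos_eq; lra.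
Qed.

(** The termwise source of both radial bounds. The factor 1 on the right matches the axis series
    taken with [c = 1]. *)
Lemma Re_mult_pow_le (c z : C) (n : nat) :
  Re (c * z ^ n)%C <= Cmod c * Re (1 * RtoC (Cmod z) ^ n)%C.
Proof.
rewrite Cmult_1_l, <- RtoC_pow; change (Re (RtoC ?x)) with x.
rewrite <- Cmod_pow, <- Cmod_mult.
apply Rle_trans with (1 := Rle_abs _); apply re_le_Cmod.
Qed.

Lemma radial_bound_value (f : C -> C) (a : nat -> R) (z : C) :
  has_nonneg_form f a -> E z ->
  Re (RtoC (Cmod z) * f (RtoC (Cmod z)))%C <= Re (z * f z)%C.
Proof.
intros Hf Hz.
(* The comparison is made on [1 - z f(z)], whose series has nonnegative coefficients; subtracting
   from 1 reverses it. *)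
assert (H : Re (1 * (1 - z * f z))%C
  <= Re (1 * (1 - RtoC (Cmod z) * f (RtoC (Cmod z))))%C).
{ apply is_series_le with (2 := form_series f a 1 z Hf Hz)
    (3 := form_series f a 1 _ Hf (E_Cmod z Hz)); intros k.
  apply Rmult_le_compat_l; [apply (proj1 Hf); lia|].
  assert (h := Re_mult_pow_le 1 z (S (S k))).
  rewrite Cmod_1, Rmult_1_l in h; exact h. }
rewrite !Cmult_1_l in H; unfold Cminus in H.
rewrite !re_plus in H; unfold Re in *; simpl in *; lra.
Qed.

(** A modulus is recovered from real parts: termwise comparison bounds [- Re (c * D)] by [|c| * X]
    for every [c], and a suitable [c] aligns [D] with the negative axis. *)
Lemma radial_bound_derive (f : C -> C) (a : nat -> R) (z : C) :
  has_nonneg_form f a -> E z ->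
  ex_derive (K := C_AbsRing) (V := C_NormedModule) f z ->
  ex_derive (K := C_AbsRing) (V := C_NormedModule) f (RtoC (Cmod z)) ->
  Cmod (z ^ 2 * C_derive f z + z * f z)%C <=
    - Re (RtoC (Cmod z) ^ 2 * C_derive f (RtoC (Cmod z))
          + RtoC (Cmod z) * f (RtoC (Cmod z)))%C.
Proof.
intros Hf Hz Hd Hdr.
assert (Hr := form_derive_series f a 1 _ Hf (E_Cmod z Hz) Hdr).
rewrite Cmult_1_l in Hr.
set (X := - Re _) in Hr |- *.
assert (Hs := fun c => form_derive_series f a c z Hf Hz Hd).
set (D := (z ^ 2 * C_derive f z + z * f z)%C) in *.
assert (Hle : forall c, - Re (c * D)%C <= Cmod c * X).
{ intros c; apply is_series_le with (2 := Hs c)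
    (3 := is_series_scal_l (Cmod c) _ _ Hr); intros k.
  apply Rle_trans with ((INR (S k) + 1) * a (S k)
    * (Cmod c * Re (1 * RtoC (Cmod z) ^ S (S k))%C)).
  - apply Rmult_le_compat_l; [|apply Re_mult_pow_le].
    apply Rmult_le_pos; [assert (h := pos_INR (S k)); lra|].
    apply (proj1 Hf); lia.
  - apply Req_le; change (scal ?x ?y) with (x * y); ring. }
(* This choice gives [|D|^2 <= |D| * X]. One cancels [|D|] when it is positive; when [D = 0], the
   choice [c = 1] gives [0 <= X]. *)
assert (H1 := Hle (- Cconj D)%C).
rewrite Cmod_opp, Cmod_conj in H1.
replace (- Re (- Cconj D * D)%C) with (Cmod D * Cmod D) in H1.
2:{ replace (Cmod D * Cmod D) with (Cmod D ^ 2) by ring.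
    rewrite Cmod2_alt; unfold Re, Im; simpl; ring. }
destruct (Cmod_ge_0 D) as [HD|HD].
- apply (Rmult_le_reg_l (Cmod D)); assumption.
- assert (H2 := Hle 1); rewrite Cmod_1, (Cmod_eq_0 D (eq_sym HD)) in H2.
  rewrite <- HD; unfold Re in H2; simpl in H2; lra.
Qed.

(** Adding [alpha] times the derivative series to the value series, both with [c = 1], produces the
    weights [1 + alpha (n+1)]. *)
Lemma axis_series (alpha : R) (f : C -> C) (a : nat -> R) (r : R) :
  has_nonneg_form f a -> E (RtoC r) ->
  ex_derive (K := C_AbsRing) (V := C_NormedModule) f (RtoC r) ->
  is_series (fun k => weighted_coef alpha a (S k) * r ^ S (S k))
    (1 - Re (RtoC r * f (RtoC r))%C
     - alpha * Re (RtoC r ^ 2 * C_derive f (RtoC r) + RtoC r * f (RtoC r))%C).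
Proof.
intros Hf Hr Hd.
assert (H1 := form_series f a 1 _ Hf Hr).
assert (H2 := form_derive_series f a 1 _ Hf Hr Hd).
apply (is_series_scal_l alpha) in H2.
assert (H := is_series_plus _ _ _ _ H1 H2).
rewrite !Cmult_1_l in H.
replace (plus (Re (1 - RtoC r * f (RtoC r))%C) _) with (1 - Re (RtoC r * f (RtoC r))%C
     - alpha * Re (RtoC r ^ 2 * C_derive f (RtoC r) + RtoC r * f (RtoC r))%C) in H.
2:{ set (D := (_ + _)%C); set (F := (_ * _)%C).
    change (1 - Re F - alpha * Re D = (Re (1 - F)%C) + alpha * (- Re D)).
    unfold Re; simpl; ring. }
revert H; apply is_series_ext; intros k.
rewrite !Cmult_1_l, <- RtoC_pow.
change (a (S k) * r ^ S (S k) + alpha * ((INR (S k) + 1) * a (S k) * r ^ S (S k))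
  = weighted_coef alpha a (S k) * r ^ S (S k)).
unfold weighted_coef; ring.
Qed.

Lemma one_add_mul_pos (alpha : R) (n : nat) :
  0 <= alpha -> 0 < 1 + alpha * (INR n + 1).
Proof.
intros Ha; assert (h := pos_INR n).
assert (H := Rmult_le_pos alpha (INR n + 1) Ha ltac:(lra)); lra.
Qed.

Lemma weighted_coef_ge_0 (alpha : R) (f : C -> C) (a : nat -> R) (k : nat) :
  0 <= alpha -> has_nonneg_form f a -> 0 <= weighted_coef alpha a (S k).
Proof.
intros Ha Hf; apply Rmult_le_pos; [|apply (proj1 Hf); lia].
apply Rlt_le, one_add_mul_pos, Ha.
Qed.

(** * Sufficiency of the coefficient bound *)

Lemma ME_of_coef_bound (alpha : R) (f : C -> C) (a : nat -> R) (s : R) :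
  0 <= alpha -> Sigma f -> has_nonneg_form f a ->
  is_series1 (weighted_coef alpha a) s -> s <= 1 -> ME alpha f.
Proof.
intros Ha HS Hf Hs Hs1; split; [exact HS|]; intros z Hz.
assert (Hz' := E_Cmod z Hz).
assert (Hv := radial_bound_value f a z Hf Hz).
assert (Hd := radial_bound_derive f a z Hf Hz (proj1 HS z Hz) (proj1 HS _ Hz')).
assert (Hx := axis_series alpha f a _ Hf Hz' (proj1 HS _ Hz')).
apply (Rmult_le_compat_l alpha _ _ Ha) in Hd.
assert (Hlt : Cmod z ^ 2 * s < 1).
{ destruct Hz as [H0 H1].
  assert (H2 : Cmod z ^ 2 < 1) by (simpl; rewrite Rmult_1_r;
    rewrite <- (Rmult_1_r 1); apply Rmult_gt_0_lt_compat; lra).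
  apply Rle_lt_trans with (2 := H2); rewrite <- (Rmult_1_r (Cmod z ^ 2)) at 2.
  apply Rmult_le_compat_l; [apply pow2_ge_0|exact Hs1]. }
(* Since [|z|^(k+2) <= |z|^2], the axis series is at most [|z|^2 * s < 1]; the radial bounds then
   carry the strict inequality to [z]. *)
assert (H := fun h => is_series_le _ _ _ _ h Hx
  (is_series_scal_l (Cmod z ^ 2) _ _ Hs)).
change (scal (Cmod z ^ 2) s) with (Cmod z ^ 2 * s) in H.
cut (forall k, weighted_coef alpha a (S k) * Cmod z ^ S (S k)
  <= scal (Cmod z ^ 2) (weighted_coef alpha a (S k))).
{ intros h; specialize (H h); lra. }
intros k; change (weighted_coef alpha a (S k) * Cmod z ^ (2 + k)
  <= Cmod z ^ 2 * weighted_coef alpha a (S k)).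
rewrite pow_add, <- (Rmult_1_r (Cmod z ^ 2 * weighted_coef alpha a (S k))).
replace (weighted_coef alpha a (S k) * (Cmod z ^ 2 * Cmod z ^ k))
  with (Cmod z ^ 2 * weighted_coef alpha a (S k) * Cmod z ^ k) by ring.
apply Rmult_le_compat_l.
- apply Rmult_le_pos; [apply pow2_ge_0|].
  apply weighted_coef_ge_0 with f; assumption.
- rewrite <- (pow1 k); apply pow_incr; destruct Hz; lra.
Qed.

(** * Necessity, by letting [r] tend to 1 *)

Lemma sum_n_le_is_series (u : nat -> R) (l : R) (N : nat) :
  (forall n : nat, 0 <= u n) -> is_series u l -> sum_n u N <= l.
Proof.
intros Hu Hl; apply (is_lim_seq_incr_compare (sum_n u)); [exact Hl|].
intros n; rewrite sum_Sn; rewrite <- (Rplus_0_r (sum_n _ n)) at 1.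
apply Rplus_le_compat_l, Hu.
Qed.

Lemma continuity_pt_le_left (g : R -> R) (M : R) :
  continuity_pt g 1 -> (forall r : R, 0 < r < 1 -> g r <= M) -> g 1 <= M.
Proof.
intros Hc Hg; apply Rnot_lt_le; intros Hlt.
destruct (Hc (g 1 - M) ltac:(lra)) as [d [Hd H]].
(* The bound [d / 2] puts [1 - e] within the continuity radius, and [1 / 2] keeps it in [(0, 1)]. *)
set (e := Rmin (d / 2) (1 / 2)).
assert (He1 : e <= d / 2) by apply Rmin_l.
assert (He2 : e <= 1 / 2) by apply Rmin_r.
assert (He : 0 < e) by (apply Rmin_glb_lt; lra).
assert (Hr := Hg (1 - e) ltac:(lra)).
specialize (H (1 - e)); simpl in H; unfold Rdist in H.
assert (H' : Rabs (g (1 - e) - g 1) < g 1 - M).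
{ apply H; split; [repeat split; lra|].
  rewrite Rabs_left; lra. }
apply Rabs_def2 in H'; lra.
Qed.

(** The limit [r -> 1] is taken in each partial sum, a polynomial in [r], so no interchange of
    limits occurs; bounded increasing partial sums then converge. *)
Lemma coef_bound_of_ME (alpha : R) (f : C -> C) (a : nat -> R) :
  0 <= alpha -> has_nonneg_form f a -> ME alpha f ->
  exists s : R, is_series1 (weighted_coef alpha a) s /\ s <= 1.
Proof.
intros Ha Hf [HS HM].
assert (Hw := fun k => weighted_coef_ge_0 alpha f a k Ha Hf).
assert (Hr : forall N r, 0 < r < 1 ->
  sum_f_R0 (fun k => weighted_coef alpha a (S k) * r ^ S (S k)) N <= 1).
{ intros N r Hr.
  assert (HE : E (RtoC r)) by (unfold E; rewrite Cmod_R, Rabs_pos_eq; lra).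
  assert (Hx := axis_series alpha f a r Hf HE (proj1 HS _ HE)).
  assert (Hm := HM _ HE).
  set (D := (RtoC r ^ 2 * C_derive f (RtoC r) + _)%C) in *.
  (* With [ME] at [r] this gives [Re (r f(r)) > - alpha * Re D], so the axis series has sum below
     1. *)
  assert (HD : - Re D <= Cmod D).
  { apply Rle_trans with (2 := re_le_Cmod D).
    rewrite <- Rabs_Ropp; apply Rle_abs. }
  apply (Rmult_le_compat_l alpha _ _ Ha) in HD.
  rewrite <- sum_n_Reals.
  apply Rle_trans with (1 := sum_n_le_is_series _ _ N
    (fun k => Rmult_le_pos _ _ (Hw k) (pow_le r _ ltac:(lra))) Hx).
  lra. }
assert (Hsum : forall N, sum_n (fun k => weighted_coef alpha a (S k)) N <= 1).
{ intros N.
  assert (H := continuity_pt_le_left _ 1 (continuity_pt_finite_SF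
    (fun k r => weighted_coef alpha a (S k) * r ^ S (S k)) N 1
    ltac:(intros k _; reg)) (Hr N)).
  cbv beta in H; rewrite <- sum_n_Reals in H; revert H; apply Rle_trans, Req_le.
  apply sum_n_ext; intros k; rewrite pow1; symmetry; apply Rmult_1_r. }
destruct (ex_finite_lim_seq_incr (sum_n (fun k => weighted_coef alpha a (S k))) 1)
  as [s Hs]; [| exact Hsum |].
{ intros n; rewrite sum_Sn; rewrite <- (Rplus_0_r (sum_n _ n)) at 1.
  apply Rplus_le_compat_l, Hw. }
exists s; split; [exact Hs|].
exact (is_lim_seq_le _ _ s 1 Hsum Hs (is_lim_seq_const 1)).
Qed.

(** * The extremal functions *)

Lemma extremal_Sigma (alpha : R) (n : nat) : Sigma (extremal_fun alpha n).
Proof.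
split.
- intros z Hz; apply (ex_derive_minus (K := C_AbsRing) (V := C_NormedModule)).
  + apply ex_derive_C_inv, E_neq_0, Hz.
  + destruct (ex_derive_C_pow n z) as [l Hl].
    set (c := RtoC (extremal_coef alpha n)); exists (c * l)%C.
    apply (filterdiff_ext_lin _ _ _ (filterdiff_scal_r_fct
      (K := C_AbsRing) (V := C_NormedModule) c _ _ Cmult_comm Hl)).
    intros y; change (c * (y * l) = y * (c * l))%C; ring.
(* The sign changes because [Sigma] expands [f z - / z], whereas [has_nonneg_form] expands
   [/ z - f z]. *)
- exists (fun k => (- RtoC (extremal_seq alpha n k))%C); intros z Hz.
  replace (extremal_fun alpha n z - / z)%C
    with (- RtoC (extremal_seq alpha n n) * z ^ n)%C.
  2:{ unfold extremal_fun, extremal_seq; rewrite Nat.eqb_refl; ring. }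
  apply (is_series_single (K := C_AbsRing) (V := C_NormedModule)
    (fun k => - RtoC (extremal_seq alpha n k) * z ^ k)%C n).
  intros k Hk; unfold extremal_seq; apply Nat.eqb_neq in Hk; rewrite Hk.
  change (- 0 * z ^ k = 0)%C; ring.
Qed.

Lemma extremal_form (alpha : R) (n : nat) :
  0 <= alpha -> (1 <= n)%nat ->
  has_nonneg_form (extremal_fun alpha n) (extremal_seq alpha n).
Proof.
intros Ha Hn; split.
- intros k _; unfold extremal_seq; destruct (Nat.eqb k n); [|lra].
  apply Rlt_le, Rinv_0_lt_compat, one_add_mul_pos, Ha.
(* [is_series1] starts at exponent 1, so the monomial of degree [S n] sits at position [n]. *)
- intros z Hz; destruct n as [|n]; [lia|].
  replace (/ z - extremal_fun alpha (S n) z)%C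
    with (RtoC (extremal_seq alpha (S n) (S n)) * z ^ S n)%C.
  2:{ unfold extremal_fun, extremal_seq; rewrite Nat.eqb_refl; ring. }
  apply (is_series_single (K := C_AbsRing) (V := C_NormedModule)
    (fun k => RtoC (extremal_seq alpha (S n) (S k)) * z ^ S k)%C n).
  intros k Hk; unfold extremal_seq.
  replace (Nat.eqb (S k) (S n)) with false by (symmetry; apply Nat.eqb_neq; lia).
  change (0 * z ^ S k = 0)%C; ring.
Qed.

Lemma extremal_weighted_series (alpha : R) (n : nat) :
  0 <= alpha -> (1 <= n)%nat ->
  is_series1 (weighted_coef alpha (extremal_seq alpha n)) 1.
Proof.
intros Ha Hn; destruct n as [|n]; [lia|].
replace 1 with (weighted_coef alpha (extremal_seq alpha (S n)) (S n)).
2:{ unfold weighted_coef, extremal_seq, extremal_coef; rewrite Nat.eqb_refl.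
    apply Rinv_r, Rgt_not_eq, one_add_mul_pos, Ha. }
apply (is_series_single
  (fun k => weighted_coef alpha (extremal_seq alpha (S n)) (S k)) n).
intros k Hk; unfold weighted_coef, extremal_seq.
replace (Nat.eqb (S k) (S n)) with false by (symmetry; apply Nat.eqb_neq; lia).
apply Rmult_0_r.
Qed.

Theorem theorem4p1 (alpha : R) (halpha : 0 <= alpha) :
  (forall (f : C -> C) (a : nat -> R),
     Sigma f -> has_nonneg_form f a ->
     (TME alpha f <->
      exists s : R, is_series1 (weighted_coef alpha a) s /\ s <= 1)) /\
  (forall n : nat, (1 <= n)%nat ->
     TME alpha (extremal_fun alpha n) /\
     has_nonneg_form (extremal_fun alpha n) (extremal_seq alpha n) /\
     is_series1 (weighted_coef alpha (extremal_seq alpha n)) 1).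
Proof.
split.
- intros f a HS Hf; split.
  + intros [HM _]; exact (coef_bound_of_ME alpha f a halpha Hf HM).
  + intros [s [Hs Hs1]]; split; [|exists a; exact Hf].
    exact (ME_of_coef_bound alpha f a s halpha HS Hf Hs Hs1).
- intros n Hn.
  assert (Hf := extremal_form alpha n halpha Hn).
  assert (Hs := extremal_weighted_series alpha n halpha Hn).
  split; [|split; assumption].
  split; [|exists (extremal_seq alpha n); exact Hf].
  exact (ME_of_coef_bound alpha _ _ 1 halpha (extremal_Sigma alpha n) Hf Hs
    (Rle_refl 1)).
Qed.
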